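(* Let $(X,d)$ be a proper, uniquely geodesic, straight metric space. Then the horoboundary $\partial\overline{X}^h$ is connected if and only if the visual boundary $D_b$ of $X$ based at some point $b\in X$ is connected (and hence, if and only if the visual boundary $D_b$ is connected for every $b\in X$).
   Context: A geodesic in a metric space $(X,d)$ is a map $\gamma:I\to X$ from an interval $I\subset\mathbb{R}$ with $d(\gamma(t),\gamma(s))=|t-s|$. $X$ is proper if closed balls are compact; uniquely geodesic if any two distinct points are joined by a unique geodesic; straight if every geodesic segment is contained in a unique bi-infinite geodesic. For $b\in X$, the visual boundary based at $b$ is the set $D_b$ of geodesic rays $\gamma:[0,\infty)\to X$ with $\gamma(0)=b$, with the topology of uniform convergence on compact sets. Let $h:X\to C(X)$, $h(x)(\cdot)=d(x,\cdot)-d(x,b)$, where $C(X)$ (continuous real functions) has the topology of uniform convergence on compact sets. $h$ is an embedding, $\overline{X}^h=\overline{h(X)}$ is compact (and independent of $b$ up to isomorphism), and the horoboundary is $\partial\overline{X}^h=\overline{X}^h\setminus h(X)$. *)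

(* Defs.v *)
From HB Require Import structures.
From mathcomp Require Import all_boot all_order all_algebra.
From mathcomp Require Import all_classical all_reals all_analysis.
Set Implicit Arguments.
Unset Strict Implicit.
Unset Printing Implicit Defensive.
Import Order.TTheory GRing.Theory Num.Theory.
Import numFieldNormedType.Exports.
Local Open Scope classical_set_scope.
Local Open Scope ring_scope.

Section geodesics.
Context {R : realType} {X : metricType R}.

(* [I] is coerced to the subtype of its elements; it is only ever instantiated
   with intervals. *)
Definition geodesic (I : set R) (g : I -> X) : Prop :=
  forall s t : I, mdist (g t) (g s) = `|\val t - \val s|.

(* [t] belongs to the domain [I] and [g t = x]. *)
Definition maps_to (I : set R) (g : I -> X) (t : R) (x : X) : Prop :=
  exists2 s : I, \val s = t & g s = x.

End geodesics.

Definition proper_space {R : realType} (X : metricType R) : Prop :=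
  forall (x : X) (r : R), compact [set y : X | mdist x y <= r].

(* A geodesic from [x] to [y] is parametrized from [0], hence by the interval
   [0, mdist x y]; this makes uniqueness a statement about maps. *)
Definition uniquely_geodesic {R : realType} (X : metricType R) : Prop :=
  forall x y : X, x != y ->
    exists! g : `[0, mdist x y]%classic -> X,
      [/\ geodesic g, maps_to g 0 x & maps_to g (mdist x y) y].

(* Containment, and hence uniqueness of the bi-infinite geodesic, is about
   images, i.e., up to reparametrization. Segments are nondegenerate: a single
   point of the plane, say, lies on many lines. *)
Definition straight {R : realType} (X : metricType R) : Prop :=
  forall (a c : R) (g : `[a, c]%classic -> X), a < c -> geodesic g ->
    exists! L : set X,
      (exists2 l : [set: R] -> X, geodesic l & L = range l) /\ range g `<=` L.

(* The type [0, +oo[ with the topology induced by that of [R]. *)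
Notation halfline R := (set_type [set t : R | 0 <= t]).

Definition visual_boundary {R : realType} {X : metricType R} (b : X) :
    set {family compact, halfline R -> X} :=
  [set g | geodesic g /\ maps_to g 0 b].

(* C(X) with the topology of uniform convergence on compact sets. *)
Definition CX {R : realType} (X : metricType R) : topologicalType :=
  initial_topology
    (fun f : continuousType X R => (f : X -> R) : {family compact, X -> R}).

Definition hfun {R : realType} {X : metricType R} (b x : X) : X -> R :=
  fun z => mdist x z - mdist x b.

Lemma hfun_continuous {R : realType} {X : metricType R} (b x : X) :
  continuous (hfun b x).
Proof.
move=> z; apply/cvgrPdist_lt => e e0; near=> w.
rewrite /hfun opprB addrA subrK.
apply: (@le_lt_trans _ _ (mdist z w)).
  have t1 := metric_triangle x z w; have t2 := metric_triangle x w z.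
  rewrite (metric_sym w z) in t2.
  by rewrite ler_distl lerBlDr t2 t1.
suff : ball z e w by rewrite ballEmdist.
by near: w; exact: nbhsx_ballx.
Unshelve. all: by end_near. Qed.

HB.instance Definition _ {R : realType} {X : metricType R} (b x : X) :=
  isContinuous.Build X R (hfun b x) (@hfun_continuous R X b x).

Definition horo_embedding {R : realType} {X : metricType R} (b x : X) : CX X :=
  (hfun b x : continuousType X R).

Definition horocompactification {R : realType} {X : metricType R} (b : X) :
    set (CX X) :=
  closure (range (horo_embedding b)).

Definition horoboundary {R : realType} {X : metricType R} (b : X) :
    set (CX X) :=
  horocompactification b `\` range (horo_embedding b).

(* Main.v *)
Require Import Defs.
From mathcomp Require Import all_boot all_order all_algebra.
From mathcomp Require Import all_classical all_reals all_analysis.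
From mathcomp Require Import ring lra.

(** Fix a base point [b] for the visual boundary and, independently, the point
[o] that normalizes the functions [h x = d(x, .) - d(x, o)].  The proof
compares the two boundaries through the relation [asymptotic b f g]: the
function [f] decreases at unit speed along the ray [g] issued from [b], that is
[f (g t) = f b - t].

A point [f] of the horoboundary is asymptotic to exactly one ray.  For
existence, write [f] as the limit of [h y] along an ultrafilter on [X]; as [f]
is not in the image of [h], this ultrafilter leaves every ball.  The lines
through [b] and [y] then converge to a line [l] (balls are compact), and
[f (l s) = f b - s] holds for all real [s], negative ones included
([horoboundary_line]).  The negative half of [l] gives uniqueness: if [f] also
decreases at unit speed along a ray [g], then
[d(l (- s), g t) >= f (l (- s)) - f (g t) = s + t], so [g] prolongs the negative
half of [l] to a line, and a straight space has only one line through a given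
segment ([ray_unique]).

Conversely, each ray [g] is asymptotic to some point of the horoboundary, any
limit of [h (g t)] as [t] grows, and the set of all such points is connected
([fiber_connected]).  Indeed, let [f] be one of them, the limit of [h y] along
an ultrafilter as above.  Follow the segment from [b] to [y] from time [N] on:
it starts near [g N] and ends at [y], so its image under [h] is a path from a
point close to [h (g N)] to a point close to [f].  As [N] grows, all limits of
points of these paths are again asymptotic to [g].  Hence no separation of the
fiber can put [f] and a limit of [h (g N)] on different sides, since the paths
would have to cross between the two sides.

Both boundaries are compact and the relation is closed.  So it behaves like
the graph of a continuous surjection with connected fibers between compact
spaces, seen from both sides, and connectedness passes through such a relation
in each direction ([connected_transfer]).  Since [b] and [o] are unrelated in
this argument, the equivalence holds for every [b]. *)

Set Implicit Arguments.
Unset Strict Implicit.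
Unset Printing Implicit Defensive.
Import Order.TTheory GRing.Theory Num.Theory.
Import numFieldNormedType.Exports.
Local Open Scope classical_set_scope.
Local Open Scope ring_scope.

(** * Relations with compact fibers *)

(** Projecting along a compact factor preserves closedness: if [k] is related
to no point of [L], finitely many of the neighborhoods given by the closedness
of [r] cover [L], and the corresponding neighborhood of [k] is free of related
points. *)
Lemma closed_projection (S T : topologicalType) (K : set S) (L : set T)
    (r : S -> T -> Prop) :
  compact L ->
  (forall k l, K k -> L l -> ~ r k l ->
     \forall k' \near k & l' \near l, K k' -> L l' -> ~ r k' l') ->
  forall k, K k -> closure (K `&` [set k' | exists2 l, L l & r k' l]) k ->
  exists2 l, L l & r k l.
Proof.
move=> /compact_near_coveringP cL clr k Kk clk; apply: contrapT => nr.
have far : \forall k' \near k, L `<=` [set l | K k' -> L l -> ~ r k' l].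
  apply: (cL _ (nbhs k) (fun k' l => K k' -> L l -> ~ r k' l)) => l Ll.
  have nkl : ~ r k l by move=> rkl; apply: nr; exists l.
  have [[U V] [/= kU lV] UV] := clr k l Kk Ll nkl.
  by exists (V, U) => // -[l' k'] [/= ? ?]; exact: (UV (k', l')).
have [k' [[Kk' [l Ll rl]] /(_ l Ll Kk' Ll)]] := clk _ far; exact.
Qed.

(** A clopen part [B] of [L] is a union of fibers, since fibers are connected;
the points of [K] related to [B] then form a clopen part of [K], as both this
set and its complement are projections of closed sets. *)
Lemma connected_transfer (S T : topologicalType) (K : set S) (L : set T)
    (r : S -> T -> Prop) :
  compact L ->
  (forall k l, K k -> L l -> ~ r k l ->
     \forall k' \near k & l' \near l, K k' -> L l' -> ~ r k' l') ->
  (forall k, K k -> exists2 l, L l & r k l) ->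
  (forall l, L l -> exists2 k, K k & r k l) ->
  (forall k, K k -> connected (L `&` r k)) ->
  connected K -> connected L.
Proof.
move=> cL clr Ktot Ltot fib cK B [b Bb] [ O oO BO] [C clC BC].
(* A fiber that meets [B] stays inside [B]. *)
have clopen k : K k -> (L `&` r k `&` C) !=set0 -> L `&` r k `<=` C.
  move=> Kk neC; have eqC : L `&` r k `&` C = L `&` r k `&` O.
    by rewrite setIAC -BC BO setIAC.
  by apply/setIidPl/fib => //; [exists O|exists C].
pose M D := K `&` [set k | exists2 l, (L `&` D) l & r k l].
have clM D : closed D -> K `&` closure (M D) `<=` M D.
  move=> clD k [Kk clk]; split => //; apply: (closed_projection _ _ Kk clk).
    exact: compact_closedI.
  move=> k0 l Kk0 [Ll _] nr; apply: filterS (clr _ _ Kk0 Ll nr).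
  by move=> -[k' l'] /= nr' Kk' [Ll' _]; exact: nr'.
have MK : M C = K.
  apply: cK.
  - have [Lb Cb] : (L `&` C) b by rewrite -BC.
    by have [k Kk rkb] := Ltot b Lb; exists k; split=> //; exists b.
  - exists (~` closure (M (~` O))); first exact/closed_openC/closed_closure.
    apply/seteqP; split=> k [Kk].
      move=> [l [Ll Cl] rkl]; split=> // clk.
      have [_ [l' [Ll' Ol'] rkl']] : M (~` O) k.
        by apply: clM; [exact: open_closedC|split].
      have Cl' : C l' by apply: (clopen k Kk) => //; exists l.
      by apply: Ol'; have [] : (L `&` O) l' by rewrite -BO BC.
    move=> nclk; split=> //; have [l Ll rkl] := Ktot k Kk; exists l => //.
    rewrite -BC BO; split=> //; apply: contrapT => Ol; apply: nclk.
    by apply: subset_closure; split=> //; exists l.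
  - exists (closure (M C)); first exact: closed_closure.
    apply/seteqP; split=> [k Mk|]; last exact: clM.
    by split; [case: Mk|exact: subset_closure].
rewrite BC; apply/setIidPl => l Ll.
have [k Kk rkl] := Ltot l Ll; have : M C k by rewrite MK.
by move=> [_ [l' [Ll' Cl'] rkl']]; apply: (clopen k Kk) => //; exists l'.
Qed.

(** * Separation and ultrafilters *)

(** Regularity gives each point of [A] a neighborhood disjoint from some
neighborhood of [B]; letting the latter range over the filter of small
neighborhoods of [B], compactness of [A] yields one that suits all of [A]. *)
Lemma compact_closed_separation (T : topologicalType) (A B : set T) :
  regular_space T -> compact A -> closed B -> A `&` B = set0 ->
  exists2 O, open O /\ A `<=` O & closure O `&` B = set0.
Proof.
have [->|/set0P B0] := eqVneq B set0.
  by exists setT; rewrite ?setI0//; split=> //; exact: openT.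
move=> regT /compact_near_coveringP cA clB AB0.
have PB : ProperFilter (set_nbhs B) by exact: set_nbhs_pfilter.
have [U BU AU] : exists2 U, set_nbhs B U & A `<=` (~` U)°.
  pose P (U : set T) := A `<=` (~` U)°.
  have mono (U V : set T) : U `<=` V -> P V -> P U.
    by move=> UV AV a Aa; apply: filterS (AV a Aa) => x /= nVx /UV.
  apply/(near_powerset_filter_fromP _ mono).
  have FB : Filter (powerset_filter_from (set_nbhs B)).
    exact: powerset_filter_from_filter.
  apply: (cA _ _ (fun U a => nbhs a (~` U)) FB) => a Aa.
  have [V aV VB] : exists2 V, nbhs a V & closure V `<=` ~` B.
    apply: regT; apply: open_nbhs_nbhs; split; first exact: closed_openC.
    by move=> Ba; have : (A `&` B) a by []; rewrite AB0.
  have BV : set_nbhs B (~` closure V).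
    move=> b Bb; apply: open_nbhs_nbhs; split; last by move=> /VB.
    exact/closed_openC/closed_closure.
  near=> a' U => /=; have Va' : V° a' by near: a'; exact: nbhs_interior.
  apply: filterS (Va') => x Vx Ux.
  have UV : U `<=` ~` closure V by near: U; exact: small_set_sub.
  by apply: (UV x) => //; exact: subset_closure.
exists (~` U)°; first by split=> //; exact: open_interior.
apply/seteqP; split=> // x [clx Bx].
by have [y [/interior_subset]] := clx U (BU x Bx).
Unshelve. all: by end_near. Qed.

Lemma fmap_ultra (S T : Type) (f : S -> T) (F : set_system S) :
  UltraFilter F -> UltraFilter (f @ F).
Proof.
move=> FU; split=> [|G GF sFG]; first exact: fmap_proper_filter.
apply/seteqP; split=> // A GA.
have [//|nA] := in_ultra_setVsetC (f @^-1` A) FU.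
have /filter_ex[x []//] : G (A `&` ~` A) by apply: filterI => //; exact: sFG.
Qed.

(** * Pointwise convergence of equicontinuous families *)

(** Equicontinuity turns closeness at [y] into closeness near [y], and finitely
many such neighborhoods cover a compact set.  Rays and horofunctions are all
1-Lipschitz, so this reduces both topologies of the theorem to pointwise
convergence. *)
Lemma equicontinuous_cvg_compact (R : numFieldType) (Y : topologicalType)
    (Z : pseudoMetricType R) (F : set_system (Y -> Z)) (W : set (Y -> Z))
    (f : Y -> Z) :
  Filter F -> F W -> W f ->
  (forall y e, 0 < e -> \forall y' \near y, forall g, W g ->
     ball (g y) e (g y')) ->
  (forall y, (fun g => g y) @ F --> f y) -> {family compact, F --> f}.
Proof.
move=> FF FW Wf equi ptw; apply/fam_cvgP => K /compact_near_coveringP cK.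
move=> U /uniform_nbhs[E [entE EU]]; apply: filterS EU _.
move: entE; rewrite -entourage_ballE => -[e /= e0 eE].
apply: (cK _ F (fun g y => E (f y, g y))) => y Ky.
have e3 : 0 < e / 3 by rewrite divr_gt0.
near=> y' g; apply: eE => /=.
have -> : e = e / 3 + e / 3 + e / 3 by field.
apply: (@ball_triangle _ _ (g y)).
  apply: (@ball_triangle _ _ (f y)).
    by apply: ball_sym; apply: (near (equi y _ e3) y').
  near: g; apply: (ptw y); exact: nbhsx_ballx.
apply: (near (equi y _ e3) y') => //.
by near: g.
Unshelve. all: by end_near. Qed.

(** * Limits in metric spaces *)

Section limits.
Context {R : realType} {X : metricType R} {I : Type} (F : set_system I).

Lemma cvg_mdist {FF : Filter F} (f g : I -> X) (x y : X) :
  f @ F --> x -> g @ F --> y -> (fun i => mdist (f i) (g i)) @ F --> mdist x y.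
Proof.
move=> /metricType_numDomainType.cvgrPdist_lt fx.
move=> /metricType_numDomainType.cvgrPdist_lt gy.
apply/cvgrPdist_lt => e e0; have e2 : 0 < e / 2 by rewrite divr_gt0.
near=> i.
have fi : mdist x (f i) < e / 2 by near: i; exact: fx.
have gi : mdist y (g i) < e / 2 by near: i; exact: gy.
have := metric_triangle x (f i) y; have := metric_triangle (f i) (g i) y.
have := metric_triangle (f i) x (g i); have := metric_triangle x y (g i).
rewrite (metric_sym (f i) x) (metric_sym (g i) y) ltr_norml.
by move: fi gi => + + + + + +; lra.
Unshelve. all: by end_near. Qed.

Lemma ultra_cvg_proper {FU : UltraFilter F} (f : I -> X) (x : X) (r : R) :
  proper_space X -> (\forall i \near F, mdist x (f i) <= r) ->
  exists y : X, f @ F --> y.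
Proof.
move=> /(_ x r); rewrite compact_ultra => cX Ff.
by have [y [_ fy]] := cX _ (fmap_ultra f FU) Ff; exists y.
Qed.

End limits.

(** * Compactness of the visual boundary *)

Definition halfline_of {R : realType} (t : R) (t0 : 0 <= t) : halfline R :=
  exist _ t (mem_set t0).

Section visual_boundary.
Context {R : realType} {X : metricType R}.

Lemma visual_boundary0 (b : X) (g : halfline R -> X) :
  visual_boundary b g -> g (halfline_of (lexx 0)) = b.
Proof. by move=> [_ [s s0 <-]]; congr g; apply: val_inj. Qed.

Lemma visual_boundary_mdist (b : X) (g : halfline R -> X) (t : halfline R) :
  visual_boundary b g -> mdist b (g t) = \val t.
Proof.
move=> Dg.
rewrite -{1}(visual_boundary0 Dg) (proj1 Dg) sub0r normrN ger0_norm//.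
by case: t => t /= /set_mem.
Qed.

(** Along an ultrafilter of rays the points [g t] stay in a closed ball, hence
converge for every [t]; the pointwise limit is again a ray. *)
Lemma visual_boundary_compact (b : X) :
  proper_space X -> compact (visual_boundary b).
Proof.
move=> properX.
rewrite compact_ultra => F FU FD.
have PF : ProperFilter F by exact: ultra_proper.
have /choice[f ptw] : forall t, exists x : X,
    (fun g : halfline R -> X => g t) @ F --> x.
  move=> t; apply: (@ultra_cvg_proper _ _ _ _ _ _ b (\val t)) => //.
  by apply: filterS FD => g Dg; rewrite (visual_boundary_mdist _ Dg).
have Df : visual_boundary b f.
  split=> [s t|].
    apply: (cvg_unique (@norm_hausdorff _ R) (cvg_mdist (ptw t) (ptw s))).
    by apply: cvg_near_cst; apply: filterS FD => g [geog _]; exact: geog.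
  exists (halfline_of (lexx 0)) => //.
  apply: (cvg_unique _ (ptw _)); first exact: metric_hausdorff.
  by apply: cvg_near_cst; apply: filterS FD => g /visual_boundary0.
exists f; split=> //.
apply: (@equicontinuous_cvg_compact R _ X F _ f _ FD Df _ ptw) => t e e0.
have : \forall t' \near t, `|\val t - \val t'| < e.
  have /cvgrPdist_lt :=
    @initial_continuous _ _ (@set_val R [set t : R | 0 <= t]) t.
  by apply.
apply: filterS => t' tt' g [geog _].
by rewrite ballEmdist/= geog.
Qed.

End visual_boundary.

(** * The horocompactification *)

Section CX.
Context {R : realType} {X : metricType R}.

(** Evaluation at [z]; points of [CX X] are bundled continuous functions, and
only their values matter below. *)
Definition ev (z : X) (f : CX X) : R := (f : continuousType X R) z.

Lemma ev_continuous (z : X) : continuous (ev z).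
Proof.
pose i (f : continuousType X R) : {family compact, X -> R} := f.
move=> f; have : i @ nbhs (f : initial_topology i) --> i f.
  exact: initial_continuous.
by move=> /pointwise_cvg_compact_family/pointwise_cvgP; exact.
Qed.

Lemma cvg_ev (I : Type) (F : set_system I) (u : I -> CX X) (f : CX X) (z : X) :
  u @ F --> f -> (fun i => ev z (u i)) @ F --> ev z f.
Proof. by move=> uf; apply: (cvg_comp u (ev z) uf); exact: ev_continuous. Qed.

Lemma CX_hausdorff : hausdorff_space (CX X).
Proof.
move=> f g fg; apply/continuousEP => z.
apply: (@norm_hausdorff _ R) => A B fA gB.
have [k [Ak Bk]] := fg _ _ (ev_continuous fA) (ev_continuous gB).
by exists (ev z k).
Qed.

Lemma CX_regular : regular_space (CX X).
Proof. exact: uniform_regular. Qed.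

Definition lipschitz1 : set (CX X) :=
  [set f | forall x y, `|ev x f - ev y f| <= mdist x y].

Lemma cvg_CX (F : set_system (CX X)) (f : CX X) :
  Filter F -> F lipschitz1 -> lipschitz1 f ->
  (forall z, ev z @ F --> ev z f) -> F --> f.
Proof.
move=> FF FL Lf ptw.
pose i (f : continuousType X R) : {family compact, X -> R} := f.
have iF : i @ F --> i f.
  pose W := [set g : X -> R | forall x y, `|g x - g y| <= mdist x y].
  apply: (@equicontinuous_cvg_compact R X R (i @ F) W (i f)) => //.
  move=> y e e0; have : nbhs y (ball y e) by exact: nbhsx_ballx.
  apply: filterS => y'; rewrite ballEmdist/= => yy' g Wg.
  exact: le_lt_trans (Wg y y') yy'.
move=> A [B [[U oU <-] Uf] BA]; apply: filterS BA _.
by apply: iF; apply: open_nbhs_nbhs.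
Qed.

Context (o : X).
Local Notation h := (horo_embedding o).

Lemma ev_horo (x z : X) : ev z (h x) = mdist x z - mdist x o.
Proof. by []. Qed.

Lemma mdist_lipschitz (x y z : X) : `|mdist x y - mdist x z| <= mdist y z.
Proof.
have := metric_triangle x y z; have := metric_triangle x z y.
by rewrite (metric_sym z y) ler_norml; lra.
Qed.

Lemma horo_lipschitz (x : X) : lipschitz1 (h x).
Proof.
by move=> y z; rewrite !ev_horo opprB addrA subrK mdist_lipschitz.
Qed.

Lemma horo_continuous : continuous (h : X -> CX X).
Proof.
move=> x; apply: cvg_CX; first exact: nearW horo_lipschitz.
  exact: horo_lipschitz.
move=> z; apply: cvgB; apply: cvg_mdist; (exact: cvg_id || exact: cvg_cst).
Qed.

(** This presents every limit of horofunctions as the limit of [h y] along an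
ultrafilter of points [y], so that limits of points, lines and values can all be
taken at once and without extracting subsequences. *)
Lemma horocompactification_ultra (f : CX X) : horocompactification o f ->
  exists W : set_system X, UltraFilter W /\ (h : X -> CX X) @ W --> f.
Proof.
move=> clf; pose G := filter_from (nbhs f) (fun N => h @^-1` N).
have PG : ProperFilter G.
  apply: filter_from_proper; last first.
    by move=> N /clf[_ [[x _ <-] Nx]]; exists x.
  apply: filter_from_filter; first by exists setT; exact: filterT.
  by move=> M N fM fN; exists (M `&` N) => //; exact: filterI.
have [W [UW GW]] := ultraFilterLemma PG; exists W; split=> // N fN.
by apply: GW; exists N.
Qed.

Lemma horocompactification_lipschitz (f : CX X) :
  horocompactification o f -> lipschitz1 f.
Proof.
move=> /horocompactification_ultra[W [UW Wf]] x y.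
apply: (@cvgr_to_le _ W _ _ (fun p => `|ev x (h p) - ev y (h p)|)).
  by apply: cvg_norm; apply: cvgB; exact: cvg_ev.
by apply: nearW => p; exact: horo_lipschitz.
Qed.

Lemma horocompactification_base (f : CX X) :
  horocompactification o f -> ev o f = 0.
Proof.
move=> /horocompactification_ultra[W [UW Wf]].
apply: (cvg_unique (@norm_hausdorff _ R) (cvg_ev Wf)).
by apply: cvg_near_cst; apply: nearW => p; rewrite ev_horo subrr.
Qed.

(** The value at [z] of a point of the horocompactification is at most [d(z, o)]
in absolute value, so pointwise limits along an ultrafilter exist; they inherit
the Lipschitz bound, which makes them continuous and the convergence uniform on
compact sets. *)
Lemma horocompactification_compact : compact (horocompactification o).
Proof.
rewrite compact_ultra => F UF Fcl.
have /choice[f ptw] : forall z, exists l : R, ev z @ F --> l.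
  move=> z; have := @segment_compact R (- mdist z o) (mdist z o).
  rewrite compact_ultra => /(_ _ (fmap_ultra (ev z) UF))[|l [_ zl]].
    apply: (@filterS _ F _ _ _ _ Fcl) => g clg; rewrite /= in_itv/= -ler_norml.
    rewrite -[ev z g]subr0 -(horocompactification_base clg).
    exact: horocompactification_lipschitz.
  by exists l.
have Lf x y : `|f x - f y| <= mdist x y.
  apply: (@cvgr_to_le _ F _ _ (fun g => `|ev x g - ev y g|)).
    by apply: cvg_norm; apply: cvgB; exact: ptw.
  by apply: filterS Fcl => g clg; exact: horocompactification_lipschitz.
have cf : continuous f.
  move=> x; apply/cvgrPdist_lt => e e0.
  have : nbhs x (ball x e) by exact: nbhsx_ballx.
  by apply: filterS => y; rewrite ballEmdist/= => /(le_lt_trans (Lf x y)).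
pose k : CX X := (mkcts cf : continuousType X R).
have Fk : F --> k.
  apply: cvg_CX => //.
  by apply: filterS Fcl => g /horocompactification_lipschitz.
exists k; split=> //.
by apply: (closed_cvg _ (@closed_closure _ _) Fcl).
Qed.

End CX.

(** * Lines in a straight space *)

Section lines.
Context {R : realType} {X : metricType R}.

(** Bi-infinite geodesics, as total functions on [R] rather than on the subtype
of elements of the full set. *)
Definition line (l : R -> X) := forall s t, mdist (l s) (l t) = `|s - t|.

Lemma geodesic_line (l : [set: R] -> X) :
  geodesic l -> line (fun s => l (exist _ s (in_setT s))).
Proof. by move=> gl s t; exact: gl. Qed.

Lemma line_geodesic (I : set R) (l : R -> X) :
  line l -> geodesic (fun s : I => l (\val s)).
Proof. by move=> ll s t; exact: ll. Qed.

Lemma line_continuous (l : R -> X) : line l -> continuous l.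
Proof.
move=> ll s; apply/metricType_numDomainType.cvgrPdist_lt => e e0.
have : nbhs s (ball s e) by exact: nbhsx_ballx.
by apply: filterS => t; rewrite /ball/= ll.
Qed.

Context (straightX : straight X).

Lemma line_range_eq (l m : R -> X) (a c : R) : a < c -> line l -> line m ->
  (forall s, a <= s <= c -> l s = m s) -> range l = range m.
Proof.
move=> ac ll lm lmE.
pose g (s : `[a, c]%classic) := l (\val s).
have [L [_ uniL]] := straightX ac (line_geodesic ll : geodesic g).
have extends k : line k -> (forall s : `[a, c]%classic, g s = k (\val s)) ->
    L = range k.
  move=> lk gk; apply: uniL; split.
    exists (fun s : [set: R] => k (\val s)); first exact: line_geodesic.
    apply/seteqP; split=> x [s _ <-]; last by exists (\val s).
    by exists (exist _ s (in_setT s)).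
  by move=> x [s _ <-]; rewrite gk; exists (\val s).
rewrite -(extends l)// -(extends m)// => s.
by apply: lmE; have := set_mem (valP s); rewrite /= in_itv.
Qed.

Lemma line_through (b y : X) : uniquely_geodesic X -> y != b ->
  exists l : R -> X, [/\ line l, l 0 = b & l (mdist b y) = y].
Proof.
move=> geodesicX yb; have by0 : 0 < mdist b y by rewrite mdist_gt0 eq_sym.
have [|g [[gg [s0 s0E gs0] [s1 s1E gs1]] _]] := geodesicX b y.
  by rewrite eq_sym.
have [L [[[l0 gl0 ->] gL] _]] := straightX by0 gg.
have [u _ lu] : range l0 b by apply: gL; exists s0.
have [v _ lv] : range l0 y by apply: gL; exists s1.
pose l s := l0 (exist _ s (in_setT s)).
have ll : line l by exact: geodesic_line.
have {}lu : l (\val u) = b by rewrite -lu; congr l0; exact: val_inj.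
have {}lv : l (\val v) = y by rewrite -lv; congr l0; exact: val_inj.
have uv : mdist b y = `|\val u - \val v| by rewrite -lu -lv ll.
have [luv|lvu] := leP (\val u) (\val v).
  exists (fun s => l (\val u + s)); split.
  - by move=> s t; rewrite ll opprD addrACA subrr add0r.
  - by rewrite addr0.
  - by rewrite uv -lv distrC ger0_norm ?subr_ge0// addrC subrK.
exists (fun s => l (\val u - s)); split.
- by move=> s t; rewrite ll distrC; congr `|_|; ring.
- by rewrite subr0.
- by rewrite uv -lv gtr0_norm ?subr_gt0// opprB addrC subrK.
Qed.

(** Since [f] is 1-Lipschitz and drops by [s + t] from [l (- s)] to [g t], these
points are at distance at least [s + t]; so [l] on the negative reals followed
by [g] is a line [m].  It shares the segment over [-1, 0] with [l], hence has
the same image, and the values of [f] identify the parameters. *)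
Lemma ray_unique (f : X -> R) (l : R -> X) (b : X) (g : halfline R -> X) :
  (forall x y, `|f x - f y| <= mdist x y) ->
  line l -> l 0 = b -> (forall s, f (l s) = f b - s) ->
  visual_boundary b g -> (forall t, f (g t) = f b - \val t) ->
  forall t, g t = l (\val t).
Proof.
move=> Lf ll l0 fl Dg fg.
have ge0 (t : halfline R) : 0 <= \val t by have := set_mem (valP t).
pose m s := if pselect (0 <= s) is left s0 then g (halfline_of s0) else l s.
have mg t : m (\val t) = g t.
  by rewrite /m; case: pselect => // s0; congr g; apply: val_inj.
have ml s : s <= 0 -> m s = l s.
  rewrite le_eqVlt => /orP[/eqP->|s0].
    rewrite l0 /m; case: pselect => [p|]; last by rewrite lexx.
    by rewrite -(visual_boundary0 Dg); congr g; apply: val_inj.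
  by rewrite /m; case: pselect => // p; move: s0; rewrite ltNge p.
have across s (t : halfline R) : s <= 0 -> mdist (l s) (g t) = \val t - s.
  move=> s0; apply/eqP; rewrite eq_le; apply/andP; split.
    apply: le_trans (metric_triangle _ b _) _.
    rewrite (visual_boundary_mdist _ Dg) -l0 ll subr0 ler0_norm//.
    by rewrite addrC.
  apply: le_trans (Lf _ _); rewrite fl fg.
  by rewrite (_ : _ - _ = \val t - s) ?ler_norm//; ring.
have lm : line m.
  move=> s t; have [s0|s0] := lerP s 0; have [t0|t0] := lerP t 0.
  - by rewrite !ml.
  - rewrite ml// -[t]/(\val (halfline_of (ltW t0))) mg across//=.
    by rewrite ler0_norm ?opprB// subr_le0 (le_trans s0)// ltW.
  - rewrite metric_sym [m t]ml// -[s]/(\val (halfline_of (ltW s0))) mg.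
    rewrite across//=.
    by rewrite ger0_norm// subr_ge0 (le_trans t0)// ltW.
  - rewrite -[s]/(\val (halfline_of (ltW s0))).
    rewrite -[t]/(\val (halfline_of (ltW t0))).
    by rewrite !mg (proj1 Dg).
have lmE : range m = range l.
  apply: (@line_range_eq m l (-1) 0) => //.
  by move=> s /andP[_]; exact: ml.
move=> t; have [u _ lu] : range l (g t) by rewrite -lmE -mg; exists (\val t).
by have := fg t; rewrite -lu fl => /addrI/oppr_inj ->.
Qed.

End lines.

(** * Horofunctions and the rays along which they decrease *)

Section asymptotic.
Context {R : realType} {X : metricType R}.

(** Decrease at unit speed along [g], as for the Busemann function of [g]. *)
Definition asymptotic (b : X) (f : CX X) (g : halfline R -> X) :=
  forall t, ev (g t) f = ev b f - \val t.

Definition lines_through (b : X) (c : X -> R -> X) :=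
  forall y, y != b -> [/\ line (c y), c y 0 = b & c y (mdist b y) = y].

Lemma exists_lines_through (b : X) : straight X -> uniquely_geodesic X ->
  exists c, lines_through b c.
Proof.
move=> straightX geodesicX.
have /choice[c cP] : forall y, exists l : R -> X,
    y != b -> [/\ line l, l 0 = b & l (mdist b y) = y].
  move=> y; have [->|yb] := eqVneq y b; first by exists (cst b).
  by have [l lP] := line_through straightX geodesicX yb; exists l.
by exists c.
Qed.

Lemma cvg_ev_moving (I : Type) (F : set_system I) (u : I -> CX X) (x : I -> X)
    (f : CX X) (z : X) : Filter F ->
  (\forall i \near F, lipschitz1 (u i)) -> u @ F --> f -> x @ F --> z ->
  (fun i => ev (x i) (u i)) @ F --> ev z f.
Proof.
move=> FF Lu uf /metricType_numDomainType.cvgrPdist_lt xz.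
have /cvgrPdist_lt ufz := cvg_ev (z := z) uf.
apply/cvgrPdist_lt => e e0; have e2 : 0 < e / 2 by rewrite divr_gt0.
near=> i.
have : `|ev z (u i) - ev (x i) (u i)| <= mdist z (x i).
  by near: i; apply: filterS Lu => i; exact.
have : `|ev z f - ev z (u i)| < e / 2 by near: i; exact: ufz.
have : mdist z (x i) < e / 2 by near: i; exact: xz.
by rewrite ler_norml !ltr_norml; lra.
Unshelve. all: by end_near. Qed.

Context (properX : proper_space X) (o : X).
Local Notation h := (horo_embedding o : X -> CX X).

(** Otherwise the ultrafilter [W] lives on a compact ball and converges to some
[x], which forces [f = h x]. *)
Lemma horoboundary_escape (f : CX X) (W : set_system X) (b : X) (r : R) :
  UltraFilter W -> h @ W --> f -> horoboundary o f ->
  \forall y \near W, r < mdist b y.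
Proof.
move=> UW Wf [_ nhf].
have [Wr|] := in_ultra_setVsetC [set y | mdist b y <= r] UW; last first.
  by apply: filterS => y /= /negP; rewrite -ltNge.
have [x xW] : exists x : X, id @ W --> x.
  exact: (@ultra_cvg_proper _ _ _ _ _ _ b r).
exfalso; apply: nhf; exists x => //.
apply: (cvg_unique CX_hausdorff _ Wf).
exact: (cvg_comp _ _ xW (@horo_continuous _ _ o x)).
Qed.

(** On the line [c y] the function [h y] decreases at unit speed up to time
[mdist b y], in particular at all negative times.  As [y] escapes to infinity,
this passes to the limit line at all times. *)
Lemma horoboundary_line (f : CX X) (W : set_system X) (b : X)
    (c : X -> R -> X) :
  UltraFilter W -> h @ W --> f -> horoboundary o f -> lines_through b c ->
  exists l : R -> X, [/\ line l, l 0 = b, forall s, ev (l s) f = ev b f - s &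
    forall s, c ^~ s @ W --> l s].
Proof.
move=> UW Wf df cP; have PW : ProperFilter W by exact: ultra_proper.
have far r := horoboundary_escape b r UW Wf df.
have Wc : \forall y \near W, [/\ line (c y), c y 0 = b & c y (mdist b y) = y].
  by apply: filterS (far 0) => y; rewrite mdist_gt0 eq_sym => /cP.
have /choice[l cl] : forall s, exists x : X, c ^~ s @ W --> x.
  move=> s; apply: (@ultra_cvg_proper _ _ _ _ _ _ b `|s|) => //.
  by apply: filterS Wc => y [ly y0 _]; rewrite -y0 ly sub0r normrN.
exists l; split=> //.
- move=> s t.
  apply: (cvg_unique (@norm_hausdorff _ R) (cvg_mdist (cl s) (cl t))).
  by apply: cvg_near_cst; apply: filterS Wc => y [ly _ _]; exact: ly.
- apply: (cvg_unique _ (cl 0)); first exact: metric_hausdorff.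
  by apply: cvg_near_cst; apply: filterS Wc => y [].
- move=> s; have cs : (fun y => ev (c y s) (h y)) @ W --> ev (l s) f.
    by apply: cvg_ev_moving => //; apply: nearW => y; exact: horo_lipschitz.
  apply: (cvg_unique (@norm_hausdorff _ R) cs).
  have bs : (fun y => ev b (h y) - s) @ W --> ev b f - s.
    by apply: cvgB; [exact: cvg_ev|exact: cvg_cst].
  apply: cvg_trans bs; apply: near_eq_cvg.
  apply: filterS2 Wc (far s) => y [ly y0 yd] sy; rewrite !ev_horo.
  have -> : mdist y (c y s) = mdist b y - s.
    by rewrite -{1}yd ly ger0_norm// subr_ge0 ltW.
  by rewrite (metric_sym y b); ring.
Qed.

Context (straightX : straight X) (geodesicX : uniquely_geodesic X).

Lemma asymptotic_exists (b : X) (f : CX X) : horoboundary o f ->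
  exists2 g, visual_boundary b g & asymptotic b f g.
Proof.
move=> df; have [W [UW Wf]] := horocompactification_ultra (proj1 df).
have [c cP] := exists_lines_through b straightX geodesicX.
have [l [ll l0 fl _]] := horoboundary_line UW Wf df cP.
exists (fun t => l (\val t)) => //.
split; first exact: line_geodesic.
by exists (halfline_of (lexx 0)).
Qed.

Lemma asymptotic_unique (b : X) (f : CX X) (g g' : halfline R -> X) :
  horoboundary o f -> visual_boundary b g -> asymptotic b f g ->
  visual_boundary b g' -> asymptotic b f g' -> g = g'.
Proof.
move=> df Dg fg Dg' fg'.
have [W [UW Wf]] := horocompactification_ultra (proj1 df).
have [c cP] := exists_lines_through b straightX geodesicX.
have [l [ll l0 fl _]] := horoboundary_line UW Wf df cP.
have Lf := horocompactification_lipschitz (proj1 df).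
have uniq := @ray_unique _ _ straightX (ev ^~ f) l b _ Lf ll l0 fl.
by apply/funext => t; rewrite (uniq g)// (uniq g').
Qed.

(** [h x] is bounded below, whereas [f] tends to minus infinity along [g]. *)
Lemma asymptotic_horoboundary (b : X) (f : CX X) (g : halfline R -> X) :
  horocompactification o f -> asymptotic b f g -> horoboundary o f.
Proof.
move=> cf fg; split=> // -[x _ xf].
have d0 : 0 <= mdist x b + 1 by rewrite addr_ge0 ?mdist_ge0.
have := fg (halfline_of d0); rewrite -xf !ev_horo /=.
by have := mdist_ge0 x (g (halfline_of d0)); lra.
Qed.

(** The failing equality at a time [t] involves [f] at [g t] and [b] only; the
Lipschitz bound controls the change of [f' (g' t)] under a change of ray. *)
Lemma near_not_asymptotic (b : X) (f : CX X)
    (g : {family compact, halfline R -> X}) :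
  ~ asymptotic b f g ->
  \forall f' \near f & g' \near g, lipschitz1 f' -> ~ asymptotic b f' g'.
Proof.
move=> /existsNP[t /eqP fgt].
have e0 : 0 < `|ev (g t) f - (ev b f - \val t)| / 3.
  by rewrite divr_gt0// normr_gt0 subr_eq0.
set e := _ / 3 in e0.
have gt : \forall g' \near g, mdist (g t) (g' t) < e.
  have : (fun g' : {family compact, halfline R -> X} => g' t) @ g --> g t.
    have : {family compact, nbhs g --> g} by exact: cvg_id.
    by move=> /pointwise_cvg_compact_family/pointwise_cvgP; exact.
  by move=> /metricType_numDomainType.cvgrPdist_lt; exact.
have fz z : \forall f' \near f, `|ev z f - ev z f'| < e.
  by have /cvgrPdist_lt := @ev_continuous _ _ z f; exact.
(* Three errors, each below a third of the gap. *)
near=> f' g' => Lf' /(_ t).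
have := Lf' (g t) (g' t).
have : mdist (g t) (g' t) < e by near: g'.
have : `|ev (g t) f - ev (g t) f'| < e by near: f'; exact: fz.
have : `|ev b f - ev b f'| < e by near: f'; exact: fz.
have : `|ev (g t) f - (ev b f - \val t)| = 3 * e by rewrite /e mulrC divfK.
rewrite ler_norml !ltr_norml.
by case: (ler0P (ev (g t) f - (ev b f - \val t))) => _; lra.
Unshelve. all: by end_near. Qed.

Lemma horoboundaryE (b : X) : horoboundary o =
  horocompactification o `&`
    [set f | exists2 g, visual_boundary b g & asymptotic b f g].
Proof.
apply/seteqP; split=> f [cf].
  by move=> nf; split=> //; exact: asymptotic_exists.
by move=> [g _]; exact: asymptotic_horoboundary.
Qed.

(** The horoboundary is the set of points of the compact horocompactification
that are asymptotic to a ray from [o], which is closed as a projection along the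
compact visual boundary. *)
Lemma horoboundary_compact : compact (horoboundary o).
Proof.
apply: (subclosed_compact _ (@horocompactification_compact _ _ o)); last first.
  by move=> f [].
rewrite (horoboundaryE o) => f clf.
have cf : horocompactification o f.
  by apply: (@closed_closure _ _ f); apply: closureS clf => k [].
split=> //.
apply: (@closed_projection _ _ (horocompactification o) (visual_boundary o)
  (asymptotic o)) => //; first exact: visual_boundary_compact.
move=> k g ck Dg /near_not_asymptotic; apply: filterS => -[k' g'] /= nr ck' _.
exact/nr/(horocompactification_lipschitz ck').
Qed.

End asymptotic.

(** * Horofunctions asymptotic to a given ray *)

Section fibers.
Context {R : realType} {X : metricType R}.
Context (o b : X).
Local Notation h := (horo_embedding o : X -> CX X).
Local Notation nat_point n := (halfline_of (ler0n R n)).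

(** The quantity [d(p, g t) - d(p, b) + t] is nonnegative and nondecreasing in
[t], by the triangle inequality; it vanishes when [p] lies beyond [g t] on the
ray.  A bound at time [n] therefore holds at all earlier times, and it tends
to 0 here. *)
Lemma asymptotic_limit (g : halfline R -> X) (U : set_system nat)
    (p : nat -> X) (f : CX X) :
  ProperFilter U -> \oo `<=` U -> visual_boundary b g ->
  (forall n, mdist (p n) (g (nat_point n)) - mdist (p n) b + n%:R
    <= n.+1%:R^-1) ->
  (h \o p) @ U --> f -> asymptotic b f g.
Proof.
move=> PU Uoo Dg pg pf t; apply/eqP; rewrite -subr_eq0; apply/eqP.
pose u n := ev (g t) (h (p n)) - (ev b (h (p n)) - \val t).
have uf : u @ U --> ev (g t) f - (ev b f - \val t).
  by apply: cvgB; [|apply: cvgB; last exact: cvg_cst]; exact: cvg_ev.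
apply: (cvg_unique (@norm_hausdorff _ R) uf).
apply/cvgrPdist_lt => e e0.
have Ut : \forall n \near U, \val t <= n%:R.
  by apply: Uoo; exact: nbhs_infty_ger.
have Ue : \forall n \near U, n.+1%:R^-1 < e.
  by apply: Uoo; exact: (near_infty_natSinv_lt (PosNum e0)).
apply: filterS2 Ut Ue => n tn ne; rewrite sub0r normrN /u !ev_horo.
have := metric_triangle (p n) (g (nat_point n)) (g t).
have := metric_triangle (p n) (g t) b.
have -> : mdist (g (nat_point n)) (g t) = n%:R - \val t.
  by rewrite (proj1 Dg) ger0_norm// subr_ge0.
rewrite (metric_sym (g t) b) (visual_boundary_mdist _ Dg) ltr_norml.
by move: (le_lt_trans (pg n) ne); lra.
Qed.

Lemma exists_ultra_nat : exists U : set_system nat,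
  UltraFilter U /\ \oo `<=` U.
Proof. exact: ultraFilterLemma. Qed.

Lemma ultra_horo_cvg (I : Type) (U : set_system I) (p : I -> X) :
  UltraFilter U ->
  exists2 f, horocompactification o f & (h \o p) @ U --> f.
Proof.
move=> UU; have := @horocompactification_compact _ _ o.
rewrite compact_ultra => /(_ _ (fmap_ultra (h \o p) UU))[|f [cf pf]].
  by apply: nearW => i; apply: subset_closure; exists (p i).
by exists f.
Qed.

Lemma ray_asymptotic (g : halfline R -> X) (U : set_system nat) :
  UltraFilter U -> \oo `<=` U -> visual_boundary b g ->
  exists f, [/\ horoboundary o f, asymptotic b f g &
    (fun n => h (g (nat_point n))) @ U --> f].
Proof.
move=> UU Uoo Dg.
have [f cf gf] := ultra_horo_cvg (fun n => g (nat_point n)) UU.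
have fg : asymptotic b f g.
  apply: (asymptotic_limit _ _ _ _ gf) => // n.
  rewrite mdistxx sub0r metric_sym (visual_boundary_mdist _ Dg) /= addNr.
  by rewrite invr_ge0.
by exists f; split=> //; exact: asymptotic_horoboundary fg.
Qed.

Context (properX : proper_space X) (straightX : straight X).
Context (geodesicX : uniquely_geodesic X).

(** The point [p] is found on the segment from [b] to a point [y] with [h y]
close to [f]: its part beyond time [N] starts near [g N], where [h] takes values
in [O], and ends at [y], where it does not, so [h] has to cross the frontier of
[O].  The segments converge to [g], so the one from [b] to [y] passes close to
[g n] before time [N], which bounds [d(p, g n)]. *)
Lemma segment_crossing (f : CX X) (g : halfline R -> X) (O : set (CX X))
    (n N : nat) :
  horoboundary o f -> visual_boundary b g -> asymptotic b f g ->
  open O -> ~ closure O f -> O (h (g (nat_point N))) -> (n <= N)%N ->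
  exists p, [/\ closure O (h p), ~ O (h p) &
    mdist p (g (nat_point n)) - mdist p b + n%:R <= n.+1%:R^-1].
Proof.
move=> df Dg fg oO nOf OgN nN.
have [W [UW Wf]] := horocompactification_ultra (proj1 df).
have PW : ProperFilter W by exact: ultra_proper.
have [c cP] := exists_lines_through b straightX geodesicX.
have [l [ll l0 fl cl]] := horoboundary_line properX UW Wf df cP.
have Lf := horocompactification_lipschitz (proj1 df).
have gl := ray_unique straightX Lf ll l0 fl Dg fg.
have Wn : \forall y \near W, mdist (g (nat_point n)) (c y n%:R) < n.+1%:R^-1.
  have /metricType_numDomainType.cvgrPdist_lt := cl n%:R.
  by rewrite gl; apply; rewrite invr_gt0 ltr0n.
have WN : \forall y \near W, O (h (c y N%:R)).
  have hl : (h \o c ^~ N%:R) @ W --> h (g (nat_point N)).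
    by rewrite gl; exact: (cvg_comp _ _ (cl N%:R) (@horo_continuous _ _ o _)).
  by have /= := hl _ (open_nbhs_nbhs (conj oO OgN)).
have Wy : \forall y \near W, ~ closure O (h y).
  have oOC : open (~` closure O) by exact/closed_openC/closed_closure.
  by have /= := Wf _ (open_nbhs_nbhs (conj oOC nOf)).
have Wd := horoboundary_escape properX b N%:R UW Wf df.
have [y [[yn yN] [nOy Ny]]] :=
  filter_ex (filterI (filterI Wn WN) (filterI Wy Wd)).
have yb : y != b.
  by rewrite eq_sym -mdist_gt0; apply: le_lt_trans Ny; exact: ler0n.
have [lc c0 cd] := cP y yb.
pose k s := h (c y s).
have kc : continuous k.
  move=> s.
  apply: (@continuous_comp _ _ _ (c y) h); first exact: line_continuous.
  exact: horo_continuous.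
have [s [/andP[Ns sd] ks nks]] : exists s, [/\ N%:R <= s <= mdist b y,
    closure O (k s) & ~ O (k s)].
  apply: contrapT => noS.
  suff Ok : `[N%:R, mdist b y] `&` k @^-1` O = `[N%:R, mdist b y]%classic.
    apply: nOy; apply: subset_closure; rewrite -cd.
    have : (`[N%:R, mdist b y]%classic : set R) (mdist b y).
      by rewrite /= in_itv/= lexx (ltW Ny).
    by rewrite -Ok => -[].
  apply: segment_connected.
  - by exists N%:R; split=> //=; rewrite in_itv/= lexx (ltW Ny).
  - by exists (k @^-1` O) => //; apply: open_comp => // s _; exact: kc.
  - exists (k @^-1` closure O).
      by apply: preimage_closed => [s _|]; [exact: kc|exact: closed_closure].
    apply/seteqP; split=> s [sI Os]; split=> //; first exact: subset_closure.
    by apply: contrapT => nOs; apply: noS; exists s.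
exists (c y s); split=> //.
have ns : n%:R <= s by apply: le_trans Ns; rewrite ler_nat.
have sb : mdist (c y s) b = s.
  by rewrite -[in LHS]c0 lc subr0 ger0_norm// (le_trans _ ns)// ler0n.
have sn : mdist (c y s) (c y n%:R) = s - n%:R.
  by rewrite lc ger0_norm// subr_ge0.
apply: le_trans (ltW yn).
have := metric_triangle (c y s) (c y n%:R) (g (nat_point n)).
by rewrite sb sn (metric_sym (c y n%:R)); lra.
Qed.

Lemma closed_asymptotic (g : halfline R -> X) :
  closed [set f | asymptotic b f g].
Proof.
rewrite (_ : [set f | _] =
    \bigcap_t ((fun f => ev (g t) f - ev b f) @^-1` [set - \val t])).
  apply: closed_bigI => t _; apply: preimage_closed; last exact: closed_eq.
  by move=> f _; apply: continuousB; exact: ev_continuous.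
apply/seteqP; split=> f /= fg t; first by move=> _ /=; rewrite fg addrC addKr.
by have /= := fg t I; lra.
Qed.

(** Let [eta] be a limit of the points [h (g n)].  If [eta] and [xi] were on
different sides, the crossing points between [g] and [xi] would have a limit in
the fiber that lies on neither side. *)
Lemma fiber_inseparable (g : halfline R -> X) (A B : set (CX X)) :
  visual_boundary b g -> closed A -> closed B ->
  horoboundary o `&` asymptotic b ^~ g = A `|` B -> A `&` B = set0 ->
  A !=set0 -> B !=set0 -> False.
Proof.
move=> Dg cA cB; set F := _ `&` _ => FAB AB0 A0 B0.
have [U [UU Uoo]] := exists_ultra_nat.
have [eta [deta etag geta]] := ray_asymptotic UU Uoo Dg.
wlog Aeta : A B cA cB FAB AB0 A0 B0 / A eta.
  move=> wl; have [] : (A `|` B) eta by rewrite -FAB.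
    exact: (wl A B).
  by apply: (wl B A) => //; [rewrite setUC|rewrite setIC].
have [xi Bxi] := B0.
have [dxi xig] : F xi by rewrite FAB; right.
have cptA : compact A.
  have cd := @horoboundary_compact _ _ properX o straightX geodesicX.
  apply: (subclosed_compact cA cd).
  by move=> f Af; have [] : F f by rewrite FAB; left.
have [ O [oO AO] OB] := compact_closed_separation CX_regular cptA cB AB0.
have nOxi : ~ closure O xi.
  by move=> Oxi; have : (closure O `&` B) xi by []; rewrite OB.
have /choice[p pP] : forall n, exists p, [/\ closure O (h p), ~ O (h p) &
    mdist p (g (nat_point n)) - mdist p b + n%:R <= n.+1%:R^-1].
  move=> n; have Un : \forall N \near U, (n <= N)%N.
    by apply: Uoo; exact: nbhs_infty_ge.
  have UO : \forall N \near U, O (h (g (nat_point N))).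
    by have /= := geta _ (open_nbhs_nbhs (conj oO (AO _ Aeta))).
  have PU : ProperFilter U by exact: ultra_proper.
  have [N [nN ON]] := filter_ex (filterI Un UO).
  exact: (segment_crossing dxi Dg xig oO nOxi ON nN).
have [zeta czeta pzeta] := ultra_horo_cvg p UU.
have zg : asymptotic b zeta g.
  by apply: (asymptotic_limit _ Uoo Dg _ pzeta) => n; have [] := pP n.
have PU : ProperFilter U by exact: ultra_proper.
have Op : \forall n \near U, closure O ((h \o p) n).
  by apply: nearW => n; have [] := pP n.
have Oz : closure O zeta.
  exact: (closed_cvg _ (@closed_closure _ O) Op zeta pzeta).
have nOp : \forall n \near U, (~` O) ((h \o p) n).
  by apply: nearW => n; have [] := pP n.
have nOz : ~ O zeta.
  exact: (closed_cvg _ (open_closedC oO) nOp zeta pzeta).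
have : (A `|` B) zeta.
  by rewrite -FAB; split=> //; exact: asymptotic_horoboundary zg.
move=> [/AO/nOz//|Bz].
by have : (closure O `&` B) zeta by []; rewrite OB.
Qed.

Lemma fiber_connected (g : halfline R -> X) :
  visual_boundary b g -> connected (horoboundary o `&` asymptotic b ^~ g).
Proof.
move=> Dg; set F := _ `&` _; have cF : closed F.
  apply: closedI; last exact: closed_asymptotic.
  apply: compact_closed; first exact: CX_hausdorff.
  exact: horoboundary_compact.
move=> B B0 [V oV BV] [C cC BC]; apply: contrapT => BF.
apply: (@fiber_inseparable g B (F `&` ~` V) Dg).
- by rewrite BC; exact: closedI.
- by apply: closedI => //; exact: open_closedC.
- by rewrite BV -setIUr setUCr setIT.
- by rewrite BV setIACA setICr setI0.
- by [].
- apply/set0P/eqP => FV; apply: BF; rewrite BV; apply/setIidPl => f Ff.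
  by apply: contrapT => nV; have : (F `&` ~` V) f by []; rewrite FV.
Qed.

(** Seen from the horoboundary, the fibers of [asymptotic b] are singletons;
seen from the visual boundary, they are the sets of [fiber_connected]. *)
Lemma connected_horoboundary_visual_boundary :
  connected (horoboundary o) <-> connected (visual_boundary b).
Proof.
have total1 := @asymptotic_exists _ _ properX o straightX geodesicX b.
have total2 g : visual_boundary b g ->
    exists2 f, horoboundary o f & asymptotic b f g.
  have [U [UU Uoo]] := exists_ultra_nat.
  by move=> /(ray_asymptotic UU Uoo)[f [? ? _]]; exists f.
split.
  apply: (@connected_transfer _ _ (horoboundary o) (visual_boundary b)
    (asymptotic b)) => //.
  - exact: visual_boundary_compact.
  - move=> f g _ _ /near_not_asymptotic; apply: filterS.
    move=> -[f' g'] /= nr [cf' _] _.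
    exact/nr/(horocompactification_lipschitz cf').
  - move=> f df; have [g Dg fg] := total1 f df.
    rewrite (_ : _ `&` _ = [set g]); first exact: connected1.
    apply/seteqP; split=> [g' [Dg' fg']|g' ->] //.
    exact: (asymptotic_unique properX straightX geodesicX df Dg' fg' Dg fg).
apply: (@connected_transfer _ _ (visual_boundary b) (horoboundary o)
  (fun g f => asymptotic b f g)) => //.
- exact: horoboundary_compact.
- move=> g f _ _ /near_not_asymptotic[[P Q] [/= fP gQ] PQ].
  exists (Q, P) => // -[g' f'] [/= Qg' Pf'] _ [cf' _].
  exact: (PQ (f', g') _ (horocompactification_lipschitz cf')).
- exact: fiber_connected.
Qed.

End fibers.

Theorem proposition1p2 (R : realType) (X : metricType R) (o : X) :
  proper_space X -> uniquely_geodesic X -> straight X ->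
  (connected (horoboundary o) <->
     exists b : X, connected (visual_boundary b)) /\
  (connected (horoboundary o) <->
     forall b : X, connected (visual_boundary b)).
Proof.
move=> properX geodesicX straightX.
have equiv b := connected_horoboundary_visual_boundary o b
  properX straightX geodesicX.
split; split=> [co|].
- by exists o; apply/equiv.
- by move=> [b /equiv].
- by move=> b; apply/equiv.
- by move=> /(_ o)/equiv.
Qed.
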